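(* Let $n\ge1$ be an integer, let $-1\le\lambda\le1$, and put $\theta=\frac{1+(-1)^{n-1}\lambda}{2}$. Let $\zeta_1,\dots,\zeta_n$ be the roots of the Jacobi polynomial $J_n(\theta,-\theta;x)$, ordered so that $|\zeta_1|\le|\zeta_2|\le\dots\le|\zeta_n|$, and let $x_i=|\zeta_i|$ and $\mathbf x=(x_1,\dots,x_n)$. Then $\sigma=\Sigma_n(\mathbf x)\in D_n$ satisfies $\langle p,\sigma-\lambda\rangle=0$ for every real even polynomial $p$ of degree at most $2n-2$.
   Context: For $f\in L^1[0,1]$ and $g\in L^\infty[0,1]$, $\langle f,g\rangle=\int_0^1 g(t)f(t)\,dt$. Let $\Delta^n=\{\mathbf x\in\mathbb R^n\mid 0\le x_1\le x_2\le\dots\le x_n\le 1\}$, and put $x_0=0$, $x_{n+1}=1$. For $\mathbf x\in\Delta^n$, $\Sigma_n(\mathbf x)\in L^\infty[0,1]$ is the class of the function with $\Sigma_n(\mathbf x)(t)=(-1)^m$ for $x_m\le t<x_{m+1}$ ($0\le m\le n$) and $\Sigma_n(\mathbf x)(1)=(-1)^n$. Let $D_n=\Sigma_n(\Delta^n)\subset L^\infty[0,1]$. The (monic) degree $n$ Jacobi polynomial with parameters $\theta,-\theta$ is the polynomial given, for $x\in(-1,1)$, by $$J_n(\theta,-\theta;x)=(-1)^n\left(\frac{1-x}{1+x}\right)^{\theta}\frac{n!}{(2n)!}\frac{d^n}{dx^n}\left\{(1+x)^{n+\theta}(1-x)^{n-\theta}\right\}.$$ *)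

(* Defs.v *)
From HB Require Import structures.
From mathcomp Require Import all_boot all_order all_algebra.
From mathcomp Require Import all_classical all_reals all_analysis.
From mathcomp Require Import complex.

Set Implicit Arguments.
Unset Strict Implicit.
Unset Printing Implicit Defensive.

Import Order.TTheory GRing.Theory Num.Theory.
Import numFieldNormedType.Exports.

Local Open Scope classical_set_scope.
Local Open Scope ring_scope.

(* Elements of L^1[0,1] and L^oo[0,1] are represented by functions on R; only
   their restriction to [0,1], up to almost everywhere equality, matters. *)
Definition pairing (R : realType) (f g : R -> R) : R :=
  \int[@lebesgue_measure R]_(t in `[0, 1]) (g t * f t).

(* x_m for 0 <= m <= n.+1, with x_0 = 0 and x_(n.+1) = 1: the tuple holds
   x_1, ..., x_n, and the default value of nth supplies the last node. *)
Definition node (R : realType) (n : nat) (x : n.-tuple R) (m : nat) : R :=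
  nth 1 (0 :: x) m.

Definition Delta (R : realType) (n : nat) : set (n.-tuple R) :=
  [set x | forall m : nat, (m <= n)%N -> node x m <= node x m.+1].

(* When x is in Delta, every t in [0,1[ lies in exactly one of the intervals. *)
Definition Sigma (R : realType) (n : nat) (x : n.-tuple R) (t : R) : R :=
  if t == 1 then (-1) ^+ n
  else \sum_(m < n.+1) (-1) ^+ m * \1_(`[node x m, node x m.+1[) t.

(* The set of all representatives of the classes Sigma_n(x), x in Delta^n. *)
Definition Dset (R : realType) (n : nat) : set (R -> R) :=
  [set s | exists2 x : n.-tuple R, Delta x &
     ae_eq (@lebesgue_measure R) `[0, 1]%classic s (Sigma x)].

(* J_n(theta, -theta; x), by definite description: a polynomial is determined
   by its values on ]-1,1[.  The weight here is (1 + x)^theta (1 - x)^-theta,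
   so in the usual convention for the Jacobi polynomials P_n^(alpha,beta) the
   parameters are alpha = -theta and beta = theta. *)
Definition jacobi (R : realType) (n : nat) (theta : R) : {poly R} :=
  xget 0 [set J : {poly R} | forall x : R, -1 < x < 1 ->
    J.[x] = (-1) ^+ n * ((1 - x) / (1 + x)) `^ theta
      * (n`!%:R / (2 * n)`!%:R)
      * derive1n n (fun y : R => (1 + y) `^ (n%:R + theta)
                               * (1 - y) `^ (n%:R - theta)) x].

(* Main.v *)
Require Import Defs.
From HB Require Import structures.
From mathcomp Require Import all_boot all_order all_algebra.
From mathcomp Require Import all_classical all_reals all_analysis.
From mathcomp Require Import complex.
From mathcomp Require Import measurable_realfun polyrcf.
From mathcomp Require Import ring lra zify.

Set Implicit Arguments.
Unset Strict Implicit.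
Unset Printing Implicit Defensive.

Import Order.TTheory GRing.Theory Num.Theory.
Import numFieldNormedType.Exports.

Local Open Scope classical_set_scope.
Local Open Scope ring_scope.

(** Write y for the Jacobi polynomial, r_1, ..., r_n for its roots and
    z(X) = y(-X).  Expanding the n-fold derivative shows that y is, up to a
    constant, the last of the polynomials [rodrigues n theta k], which gives two
    facts.

    First, the roots of y are real and lie in [-1, 1].  Each derivation turns P
    into (a(1 - X) - b(1 + X)) P + (1 - X^2) P' with a > 0 and b >= 0, and the
    roots of the latter that are not on a charge are equilibrium points of
    nonnegative charges at -1, 1 and the roots of P; as in the theorem of Gauss
    and Lucas, they stay in the convex hull of the charges
    ([gauss_lucas_segment]).

    Second, the odd power sums of the roots of exponents 1, 3, ..., 2n - 1 are all
    equal to theta.  Indeed y satisfies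
    (1 - X^2) y'' + (2 theta - 2 X) y' + n(n+1) y = 0, z satisfies the same
    equation with - theta for theta, and combining the two shows that
    (1 - X^2)(y z' - y' z) - 2 theta y z is constant ([reflection_wronskian]).
    Dividing by y z and expanding at infinity, z'/z - y'/y is -2 times the
    generating series of the odd power sums, and (1 - X^2)(z'/z - y'/y) differs
    from 2 theta by O(X^(-2n)) ([odd_power_sums]).

    It remains to replace the signed roots by their moduli x_1 <= ... <= x_n.
    Let f be the step function on [0, 1] whose value at t is the number of roots
    above t minus the number of roots below -t.  The power sums say that f - theta
    is orthogonal on [0, 1] to the even polynomials of degree at most 2n - 2.  But
    f is integer-valued, with n steps of height 1 located at the x_i.  If f - theta
    had fewer than n sign changes, some even polynomial of degree at most 2n - 2
    would have the same signs, and f would be equal to theta almost everywhere;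
    otherwise every step crosses theta.  In both cases f only takes the values 0
    and 1 ([step_values_in01]).  As its parity changes at each step and it ends
    with the value 0, this determines it: sigma - lambda is a constant multiple of
    f - theta, and the same orthogonality is the conclusion. *)

(** * The polynomial part of iterated derivatives of the weight *)

(** The k-th derivative of (1+x)^(n+theta) (1-x)^(n-theta) is
    (1+x)^(n+theta-k) (1-x)^(n-theta-k) times this polynomial; the recursion is
    the product rule, with (n+theta-k)(1-x) - (n-theta-k)(1+x) written as
    2 theta - 2(n-k) x. *)
Fixpoint rodrigues (R : comNzRingType) (n : nat) (theta : R) (k : nat) : {poly R} :=
  if k is j.+1 then
    (2%:R * theta%:P - 2%:R * (n%:R - j%:R) * 'X) * rodrigues n theta j
    + (1 - 'X ^+ 2) * (rodrigues n theta j)^`()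
  else 1.

Lemma rodriguesS (R : comNzRingType) (n : nat) (theta : R) (k : nat) :
  rodrigues n theta k.+1 =
    (2%:R * theta%:P - 2%:R * (n%:R - k%:R) * 'X) * rodrigues n theta k
    + (1 - 'X ^+ 2) * (rodrigues n theta k)^`().
Proof. by []. Qed.

(** The weight u = (1+x)^(n+theta) (1-x)^(n-theta) satisfies
    (1-x^2) u' = (2 theta - 2 n x) u; deriving this k more times by the Leibniz
    rule yields a three-term recurrence, and comparing it with the recursion
    that defines [rodrigues] leaves this lowering relation. *)
Lemma rodrigues_ladder (R : comNzRingType) (n : nat) (theta : R) (k : nat) :
  (rodrigues n theta k.+1)^`() =
  - (k.+1%:R * (2%:R * n%:R - k%:R)) * rodrigues n theta k.
Proof.
elim: k => [|k IH].
  by rewrite /= !poly.derivE !mulr0n; ring.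
rewrite rodriguesS derivD !derivM IH derivM derivN.
rewrite [rodrigues n theta k.+1]rodriguesS.
set P := rodrigues n theta k.
rewrite -!polyC_natr !poly.derivE -!natr1 /= ?mulr0n.
ring.
Qed.

Lemma is_derive_jacobi_weight (R : realType) (a b : R) (p : {poly R}) (x : R) :
  -1 < x < 1 ->
  is_derive x 1 (fun y => (1 + y) `^ a * (1 - y) `^ b * p.[y])
    ((1 + x) `^ (a - 1) * (1 - x) `^ (b - 1) *
      ((a * (1 - x) - b * (1 + x)) * p.[x] + (1 - x ^+ 2) * (deriv p).[x])).
Proof.
move=> /andP[x1 x2].
have p1 : 0 < 1 + x by lra.
have p2 : 0 < 1 - x by lra.
have d1 : is_derive x 1 (fun y : R => 1 + y) 1.
  have -> : (fun y : R => 1 + y) = horner (1 + 'X).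
    by apply/funext => y; rewrite !hornerE.
  apply: (is_derive_eq (is_derive_poly _ _)).
  by rewrite !poly.derivE !hornerE ?add0r.
have d2 : is_derive x 1 (fun y : R => 1 - y) (-1).
  have -> : (fun y : R => 1 - y) = horner (1 - 'X).
    by apply/funext => y; rewrite !hornerE.
  apply: (is_derive_eq (is_derive_poly _ _)).
  by rewrite !poly.derivE !hornerE ?sub0r.
have h1 : is_derive x 1 (fun y : R => (1 + y) `^ a) (a * (1 + x) `^ (a - 1)).
  apply: (is_derive_eq (is_derive1_comp (is_derive1_powR a p1) d1)).
  by rewrite mulr1.
have h2 : is_derive x 1 (fun y : R => (1 - y) `^ b) (- (b * (1 - x) `^ (b - 1))).
  have := @is_derive1_comp _ (fun y : R => y `^ b) (fun y : R => 1 - y)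
    _ _ _ (is_derive1_powR b p2) d2.
  by rewrite mulrN1.
have e1 : (1 + x) `^ a = (1 + x) * (1 + x) `^ (a - 1).
  rewrite powRB ?(gt_eqF p1) ?implybT // powRr1 ?ltW //.
  by rewrite mulrCA mulfV ?mulr1 // gt_eqF.
have e2 : (1 - x) `^ b = (1 - x) * (1 - x) `^ (b - 1).
  rewrite powRB ?(gt_eqF p2) ?implybT // powRr1 ?ltW //.
  by rewrite mulrCA mulfV ?mulr1 // gt_eqF.
have h3 : is_derive x 1 (horner p) ((deriv p).[x]) by exact: is_derive_poly.
apply: (is_derive_eq (is_deriveM (is_deriveM h1 h2) h3)).
rewrite /GRing.scale /= fctE e1 e2; ring.
Qed.

Lemma rodrigues_formula (R : realType) (n k : nat) (theta x : R) : -1 < x < 1 ->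
  derive1n k (fun y : R => (1 + y) `^ (n%:R + theta)
                         * (1 - y) `^ (n%:R - theta)) x =
  (1 + x) `^ (n%:R + theta - k%:R) * (1 - x) `^ (n%:R - theta - k%:R)
    * (rodrigues n theta k).[x].
Proof.
elim: k x => [|k IH] x hx; first by rewrite /= !subr0 hornerC mulr1.
rewrite derive1nS derive1E.
have xin : \near x, derive1n k (fun y : R => (1 + y) `^ (n%:R + theta)
                                           * (1 - y) `^ (n%:R - theta)) x =
      (1 + x) `^ (n%:R + theta - k%:R) * (1 - x) `^ (n%:R - theta - k%:R)
    * (rodrigues n theta k).[x].
  have : \forall y \near x, y \in `]-1, 1[ by apply: near_in_itvoo; rewrite in_itv.
  by apply: filterS => y; rewrite in_itv => /IH.
rewrite (near_eq_derive _ xin).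
have [_ ->] := is_derive_jacobi_weight (n%:R + theta - k%:R)
  (n%:R - theta - k%:R) (rodrigues n theta k) hx.
rewrite -natr1 !opprD !addrA; congr (_ * _).
rewrite /= !(hornerE, hornerXn) -!polyC_natr !hornerE /=; ring.
Qed.

(** Two polynomials that agree on ]-1, 1[ are equal, since they agree at the
    points 1/2, 1/3, 1/4, ...  When no polynomial has the prescribed values,
    the definite description returns 0. *)
Lemma jacobi_rodrigues (R : realType) (n : nat) (theta : R) :
  jacobi n theta != 0 ->
  jacobi n theta = ((-1) ^+ n * (n`!%:R / (2 * n)`!%:R)) *: rodrigues n theta n.
Proof.
rewrite /jacobi; case: xgetP => [J _ hJ _|_]; last by rewrite eqxx.
set q := _ *: _.
have agree (x : R) : -1 < x < 1 -> J.[x] = q.[x].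
  move=> hx; rewrite hJ // rodrigues_formula // /q hornerZ.
  have p1 : 0 < 1 + x by lra.
  have p2 : 0 < 1 - x by lra.
  have -> : n%:R + theta - n%:R = theta by ring.
  have -> : n%:R - theta - n%:R = - theta by ring.
  rewrite powRM ?invr_ge0 ?ltW // -[(1 + x)^-1]powR_inv1 ?ltW //.
  rewrite -powRrM mulN1r !powRN.
  have a1 : (1 + x) `^ theta != 0 by rewrite gt_eqF // powR_gt0.
  have a2 : (1 - x) `^ theta != 0 by rewrite gt_eqF // powR_gt0.
  by field; rewrite a1 a2 pnatr_eq0 -lt0n fact_gt0.
pose rs : seq R := [seq (i.+2%:R)^-1 | i <- iota 0 (size (J - q)%R)].
apply: subr0_eq; apply: (@roots_geq_poly_eq0 _ _ rs).
- apply/allP => _ /mapP[i _ ->]; rewrite /root hornerD hornerN agree ?subrr //.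
  rewrite invf_lt1 ?ltr0n // ltr1n andbT.
  by rewrite (lt_trans (ltrN10 R)) // invr_gt0 ltr0n.
- rewrite map_inj_uniq ?iota_uniq // => i j /invr_inj/eqP.
  by rewrite eqr_nat => /eqP[].
- by rewrite size_map size_iota.
Qed.

(** * The differential equation and the reflected solution *)

Definition jacobi_ode (R : comNzRingType) (n : nat) (theta : R)
    (y : {poly R}) : Prop :=
  (1 - 'X ^+ 2) * y^`()^`() + (2%:R * theta%:P - 2%:R * 'X) * y^`()
   + n%:R * (n%:R + 1) * y = 0.

(** Going one step down the ladder and one step up again. *)
Lemma rodrigues_ode (R : comNzRingType) (n : nat) (theta : R) :
  jacobi_ode n theta (rodrigues n theta n).
Proof.
rewrite /jacobi_ode; case: n => [|n]; first by rewrite /= !poly.derivE; ring.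
rewrite rodrigues_ladder [in X in _ + X = _]rodriguesS.
set P := rodrigues _ theta n.
by rewrite -!polyC_natr !poly.derivE /= -!natr1; ring.
Qed.

Lemma jacobi_ode_scale (R : comNzRingType) (n : nat) (theta c : R)
    (y : {poly R}) :
  jacobi_ode n theta y -> jacobi_ode n theta (c *: y).
Proof.
rewrite /jacobi_ode => /(congr1 (fun q => c%:P * q)).
by rewrite -mul_polyC !poly.derivE mulr0 => <-; ring.
Qed.

Lemma jacobi_ode_reflect (R : comNzRingType) (n : nat) (theta : R)
    (y : {poly R}) :
  jacobi_ode n theta y -> jacobi_ode n (- theta) (y \Po (- 'X)).
Proof.
rewrite /jacobi_ode => /(congr1 (fun p => p \Po (- 'X))).
rewrite -!polyC_natr.
rewrite !(comp_polyB, comp_polyD, comp_polyM, comp_polyC, comp_polyX).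
rewrite polyC0 polyC1 polyCN !(deriv_comp, poly.derivE) /= => h.
by rewrite -[RHS]h; ring.
Qed.

(** If L and L' are the operators that annihilate y and its reflection z, then
    this derivative is y L'(z) - z L(y): the second-order terms and n(n+1) y z
    combine into (1 - X^2)(y z' - y' z) and its derivative, and the first-order
    terms give the derivative of - 2 theta y z. *)
Lemma reflection_wronskian (R : comNzRingType) (n : nat) (theta : R)
    (y : {poly R}) (z := y \Po (- 'X)) :
  jacobi_ode n theta y ->
  ((1 - 'X ^+ 2) * (y * z^`() - y^`() * z) - 2%:R * theta%:P * y * z)^`() = 0.
Proof.
move=> hy; have := jacobi_ode_reflect hy; move: hy; rewrite -/z /jacobi_ode.
set Ly := (X in X = 0 -> _) => hy; set Lz := (X in X = 0 -> _) => hz.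
transitivity (y * Lz - z * Ly); last by rewrite hy hz !mulr0 subrr.
by rewrite /Ly /Lz polyCN -!polyC_natr !poly.derivE /=; ring.
Qed.

(** * Odd power sums of the roots *)

Lemma polyC_of_deriv0 (R : numDomainType) (p : {poly R}) : p^`() = 0 -> p = (p`_0)%:P.
Proof.
move=> hp; apply/polyP => -[|i]; rewrite coefC //=.
have := congr1 (fun q : {poly R} => q`_i) hp.
by rewrite coef_deriv coef0 => /eqP; rewrite mulrn_eq0 => /eqP.
Qed.

Lemma deriv_prod (R : comNzRingType) (I : finType) (f : I -> {poly R}) :
  (\prod_i f i)^`() = \sum_i (f i)^`() * \prod_(j | j != i) f j.
Proof.
elim: (index_enum I) (index_enum_uniq I) => [|x s IH] /=.
  by rewrite !big_nil derivC.
move=> /andP[xs us]; rewrite !big_cons derivM eqxx /= IH //; congr (_ * _ + _).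
  rewrite big_seq_cond [RHS]big_seq_cond; apply: eq_bigl => i.
  by case: eqVneq => [->|]; rewrite ?(negPf xs) // !andbT.
rewrite mulr_sumr big_seq [RHS]big_seq; apply: eq_bigr => i si.
have xi : x != i by apply: contraNneq xs => ->.
by rewrite big_cons xi mulrCA.
Qed.

Lemma size_prod_XsubC_cond (R : nzRingType) (I : finType) (P : pred I)
    (a : I -> R) :
  size (\prod_(i | P i) ('X - (a i)%:P)) = #|P|.+1.
Proof.
by rewrite -big_filter size_prod_XsubC size_filter -sum1_count sum1_card.
Qed.

(** With M the product of the X - a_j, the hypothesis says that the sum of the
    r_i / (X - a_i) is (theta + c / M) / (X - 1); expanding at infinity, where
    c / M is O(X^(-n)), the first n coefficients of both sides agree.  The proof
    stays with polynomials: S k below is the sum of the r_i a_i^k M / (X - a_i)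
    minus its value for k = 0, its coefficient of index n-1 is the difference of
    the k-th and 0-th sums, and the induction shows that this coefficient
    vanishes because S k has size at most k. *)
Lemma power_sums_of_partial_fractions (F : fieldType) (n : nat) (r a : 'I_n -> F)
  (theta c : F) (N := fun i => \prod_(j | j != i) ('X - (a j)%:P))
  (hN : ('X - 1) * (\sum_i r i *: N i) =
        theta *: \prod_i ('X - (a i)%:P) + c%:P)
  (k : nat) : (k < n)%N -> \sum_i r i * a i ^+ k = theta.
Proof.
case: n r a @N hN => [|n] r a N hN; first by [].
set M := \prod_i _ in hN; set T := \sum_i _ in hN.
pose p k := \sum_i r i * a i ^+ k.
pose S k := \sum_i (r i * a i ^+ k) *: N i - T.
have NM i : ('X - (a i)%:P) * N i = M by rewrite /M (bigD1 i).
have coefN i : (N i)`_n = 1.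
  have mN : N i \is monic by exact: monic_prod_XsubC.
  have sN : size (N i) = n.+1.
    by rewrite size_prod_XsubC_cond cardC1 card_ord.
  by move/monicP: mN; rewrite lead_coefE sN.
have coefS j : (S j)`_n = p j - p 0%N.
  rewrite /S /T coefB !coef_sum; congr (_ - _); apply: eq_bigr => i _.
    by rewrite coefZ coefN mulr1.
  by rewrite coefZ coefN expr0.
have p0 : p 0%N = theta.
  have sM : M`_n.+1 = 1.
    have mM : M \is monic by exact: monic_prod_XsubC.
    by move/monicP: mM; rewrite lead_coefE size_prod_XsubC_cond card_ord.
  have sT : (size T <= n.+1)%N.
    apply: (leq_trans (size_sum _ _ _)); apply/bigmax_leqP => i _.
    apply: (leq_trans (size_scale_leq _ _)).
    by rewrite size_prod_XsubC_cond cardC1 card_ord.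
  have := congr1 (fun q : {poly F} => q`_n.+1) hN.
  rewrite mulrBl mul1r coefB coefXM coefD coefZ sM coefC mulr1 addr0 /=.
  rewrite (nth_default _ sT) subr0 => <-.
  rewrite coef_sum; apply: eq_bigr => i _.
  by rewrite coefZ coefN expr0.
(* X N_i = a_i N_i + M, so passing from k to k + 1 amounts to multiplying by X
   and adding a multiple of M and a constant. *)
have Sstep j : S j.+1 = 'X * S j + (theta - p j) *: M + c%:P.
  rewrite /S mulrBr mulr_sumr scalerBl.
  have -> : \sum_i (r i * a i ^+ j.+1) *: N i =
     \sum_i 'X * ((r i * a i ^+ j) *: N i) - p j *: M.
    rewrite /p scaler_suml -sumrB; apply: eq_bigr => i _.
    rewrite -(NM i) exprSr -!mul_polyC !polyCM; ring.
  have -> : theta *: M = ('X - 1) * T - c%:P by rewrite hN addrK.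
  ring.
suff: (k < n.+1)%N -> (size (S k) <= k)%N.
  move=> sS ltk; have := coefS k; rewrite nth_default; last first.
    by rewrite (leq_trans (sS ltk)).
  by rewrite p0 => /esym/eqP; rewrite subr_eq0 => /eqP.
elim: k => [|k IH] ltk.
  rewrite (_ : S 0%N = 0) ?size_poly0 // /S /T -sumrB big1 // => i _.
  by rewrite expr0 mulr1 subrr.
have sk := IH (ltnW ltk).
have pk : theta - p k = 0.
  have := coefS k; rewrite nth_default; last by rewrite (leq_trans sk) // ltnW.
  by rewrite p0 => /eqP; rewrite eq_sym subr_eq0 => /eqP ->; rewrite subrr.
rewrite Sstep pk scale0r addr0.
apply: (leq_trans (size_polyD _ _)); rewrite geq_max; apply/andP; split.
  rewrite mulrC; apply: (leq_trans (size_polyMleq _ _)).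
  by rewrite size_polyX addn2 /= ltnS.
exact: (leq_trans (size_polyC_leq1 _)).
Qed.

(** If w is the product of the X + r_i, then y w and y w' - y' w are
    polynomials in X^2: the product of the X^2 - r_i^2, and -2 times the sum
    of the r_i times that product deprived of its i-th factor.  In the variable
    X^2 the constancy of the Wronskian expression is thus an identity between
    partial fractions with poles at the r_i^2. *)
Lemma odd_power_sums (F : numFieldType) (n : nat) (r : 'I_n -> F) (theta : F)
  (y := \prod_i ('X - (r i)%:P)) (z := y \Po (- 'X))
  (hyz : ((1 - 'X ^+ 2) * (y * z^`() - y^`() * z) - 2%:R * theta%:P * y * z)^`() = 0)
  (k : nat) : (k < n)%N -> \sum_i r i ^+ k.*2.+1 = theta.
Proof.
move=> ltk.
pose N i : {poly F} := \prod_(j | j != i) ('X - (r j ^+ 2)%:P).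
pose M : {poly F} := \prod_i ('X - (r i ^+ 2)%:P).
pose w : {poly F} := \prod_i ('X + (r i)%:P).
have zw : z = (-1) ^+ n *: w.
  rewrite /z /y rmorph_prod /=.
  transitivity (\prod_(i in 'I_n) - ('X + (r i)%:P)).
    by apply: eq_bigr => i _; rewrite comp_polyB comp_polyX comp_polyC opprD.
  by rewrite prodrN card_ord -mul_polyC rmorphXn rmorphN1.
pose G := (1 - 'X) * (- 2%:R * \sum_i r i *: N i) - 2%:R * theta%:P * M.
have sqX i :
    ('X - (r i)%:P) * ('X + (r i)%:P) = ('X - (r i ^+ 2)%:P) \Po 'X ^+ 2.
  by rewrite comp_polyB comp_polyX comp_polyC polyCM; ring.
have yw : y * w = M \Po 'X ^+ 2.
  rewrite /y /w -big_split /M rmorph_prod.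
  by apply: eq_bigr => i _; exact: sqX.
have dy : y^`() = \sum_i \prod_(j | j != i) ('X - (r j)%:P).
  rewrite /y deriv_prod; apply: eq_bigr => i _.
  by rewrite derivXsubC mul1r.
have dw : w^`() = \sum_i \prod_(j | j != i) ('X + (r j)%:P).
  rewrite /w deriv_prod; apply: eq_bigr => i _.
  by rewrite derivD derivX derivC addr0 mul1r.
have wr : y * w^`() - y^`() * w = (- 2%:R * \sum_i r i *: N i) \Po 'X ^+ 2.
  rewrite dw dy mulr_sumr mulr_suml -sumrB mulr_sumr rmorph_sum.
  apply: eq_bigr => i _ /=.
  have -> : (- 2%:R * (r i *: N i)) \Po 'X^2 =
            - 2%:R * (r i *: (N i \Po 'X^2)).
    by rewrite -polyC_natr -polyCN !mul_polyC !comp_polyZ.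
  rewrite /y /w (bigD1 i) //= [\prod_i ('X + _)](bigD1 i) //=.
  rewrite /N rmorph_prod /= -(eq_bigr _ (fun j _ => sqX j)) big_split /=.
  rewrite -mul_polyC; ring.
have GE : G \Po 'X^2 =
  (1 - 'X ^+ 2) * (y * w^`() - y^`() * w) - 2%:R * theta%:P * y * w.
  rewrite wr -mulrA yw /G -!polyC_natr.
  by rewrite !(comp_polyB, comp_polyM, comp_polyC, comp_polyX).
have dG : (G \Po 'X^2)^`() = 0.
  move: hyz; rewrite zw derivZ -!scalerAr -scalerBr -!scalerAr -scalerBr.
  rewrite derivZ -GE.
  by move=> /eqP; rewrite scaler_eq0 signr_eq0 /= => /eqP.
have GC : G = (G.[0])%:P.
  apply/eqP; rewrite -subr_eq0.
  have <- := @comp_poly_eq0 _ (G - (G.[0])%:P) ('X^2 : {poly F}); last first.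
    by rewrite size_polyXn.
  rewrite comp_polyB comp_polyC {1}(polyC_of_deriv0 dG) -horner_coef0.
  by rewrite horner_comp hornerXn expr0n subrr.
rewrite (eq_bigr (fun i => r i * (r i ^+ 2) ^+ k)); last first.
  by move=> i _; rewrite -exprM mul2n exprS.
apply: (@power_sums_of_partial_fractions _ n r (fun i => r i ^+ 2) theta
  (G.[0] / 2%:R)) => //.
have two0 : (2%:R : {poly F}) != 0 by rewrite -polyC_natr polyC_eq0 pnatr_eq0.
apply: (mulfI two0).
have -> : (G.[0] / 2%:R)%:P = (2%:R : F)^-1%:P * G by rewrite mulrC polyCM -GC.
rewrite mulrDr [2%:R * (_ * G)]mulrA -{3}polyC_natr -polyCM.
rewrite mulfV ?pnatr_eq0 // mul1r.
rewrite -mul_polyC /G -/M /N; ring.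
Qed.

Lemma jacobi_power_sums (R : realType) (n : nat) (theta : R) (r : 'I_n -> R) :
  jacobi n theta = \prod_i ('X - (r i)%:P) ->
  forall k, (k < n)%N -> \sum_i r i ^+ k.*2.+1 = theta.
Proof.
move=> Jr k kn; apply: odd_power_sums => //; rewrite -Jr.
have J0 : jacobi n theta != 0.
  by rewrite Jr monic_neq0 // monic_prod_XsubC.
rewrite (jacobi_rodrigues J0); apply: (@reflection_wronskian _ n).
exact/jacobi_ode_scale/rodrigues_ode.
Qed.

(** * Location of the roots *)

Definition in_segment (R : rcfType) (w : R[i]) : bool :=
  (complex.Im w == 0) && (-1 <= complex.Re w <= 1).

(** The inverses of the w - t lie in a common open half-plane, and h is a factor
    that sends it to the right half-plane: i Im w if w is not real, and w
    itself if w is real, hence of modulus above 1. *)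
Lemma segment_separation (R : rcfType) (w : R[i]) : ~~ in_segment w ->
  exists h : R[i], forall t : R, -1 <= t <= 1 -> 0 < complex.Re (h / (w - t%:C%C)).
Proof.
case: w => x y; rewrite /in_segment /=.
have [->|y0] /= := eqVneq y 0.
  move=> hx; exists (x%:C)%C => t /andP[t1 t2].
  have xt : 0 < x * (x - t).
    by move: hx; rewrite negb_and -!ltNge => /orP[] hx; nra.
  rewrite /= !(subrr, oppr0, mul0r, mulr0, subr0, expr0n, addr0) /=.
  rewrite mulrA divr_gt0 // exprn_even_gt0 //=.
  by apply: contraTneq xt => ->; rewrite mulr0 ltxx.
move=> _; exists (0 +i* y)%C => t _.
rewrite /= mul0r sub0r mulrN opprK subr0 mulrA -expr2.
by rewrite divr_gt0 ?ltr_wpDl ?sqr_ge0 // exprn_even_gt0.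
Qed.

Lemma deriv_prod_XsubC_div (F : fieldType) (s : seq F) (w : F)
    (P := \prod_(r <- s) ('X - r%:P)) :
  w \notin s -> P^`().[w] = P.[w] * \sum_(r <- s) (w - r)^-1.
Proof.
rewrite /P; elim: s {P} => [|r s IH].
  by rewrite !big_nil derivC horner0 mulr0.
rewrite inE negb_or => /andP[wr ws]; rewrite !big_cons derivM !hornerE derivXsubC.
rewrite IH // hornerC; have : w - r != 0 by rewrite subr_eq0.
by move=> h; field.
Qed.

(** At a point w that is not a root of P, the polynomial is
    (1 - w^2) P(w) times a/(w+1) + b/(w-1) + the sum of the 1/(w-r) over the
    roots r of P.  Outside the segment, these inverses lie in a common open
    half-plane, so a combination with nonnegative weights, one of them
    positive, cannot vanish. *)
Lemma gauss_lucas_segment (R : rcfType) (a b : R) (P : {poly R[i]}) (w : R[i]) :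
  0 < a -> 0 <= b ->
  (forall r, root P r -> in_segment r) ->
  root (((a%:C)%C%:P * (1 - 'X) - (b%:C)%C%:P * (1 + 'X)) * P
        + (1 - 'X ^+ 2) * P^`()) w ->
  in_segment w.
Proof.
move=> a0 b0 hP hw; apply/negPn/negP => nw.
have [h hh] := segment_separation nw.
have [s Ps] := closed_field_poly_normal P.
have P0 : P.[w] != 0 by apply: contra nw => /hP.
have lP : lead_coef P != 0.
  by apply: contraNneq P0 => /eqP; rewrite lead_coef_eq0 => /eqP ->; rewrite horner0.
have sK r : r \in s -> in_segment r.
  by move=> rs; apply: hP; rewrite Ps rootZ // root_prod_XsubC.
have ws : w \notin s by apply: contra nw => /sK.
have dP : P^`().[w] = P.[w] * \sum_(r <- s) (w - r)^-1.
  by rewrite Ps derivZ !hornerZ deriv_prod_XsubC_div // mulrA.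
have w1 : w - 1 != 0.
  apply: contra nw; rewrite subr_eq0 => /eqP ->.
  by rewrite /in_segment /= eqxx lexx; lra.
have w2 : w + 1 != 0.
  apply: contra nw; rewrite addr_eq0 => /eqP ->.
  by rewrite /in_segment /= oppr0 eqxx lexx; lra.
move: hw; rewrite /root !hornerE dP.
have -> : (a%:C%C * (1 - w) - b%:C%C * (1 + w)) * P.[w] +
   (1 - w ^+ 2) * (P.[w] * (\sum_(r <- s) (w - r)^-1)) =
   (1 - w ^+ 2) * P.[w] *
   (a%:C%C / (w + 1) + b%:C%C / (w - 1) + \sum_(r <- s) (w - r)^-1).
  by field; rewrite w1 w2.
rewrite mulf_eq0 mulf_eq0 (negPf P0) orbF.
have -> /= : (1 - w ^+ 2 == 0) = false.
  rewrite -oppr_eq0 opprB (_ : w ^+ 2 - 1 = (w - 1) * (w + 1)); last by ring.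
  by rewrite mulf_eq0 (negPf w1) (negPf w2).
move=> /eqP/(congr1 (fun v => complex.Re (h * v))); rewrite mulr0.
have ReD (u v : R[i]) : complex.Re (u + v) = complex.Re u + complex.Re v.
  by case: u; case: v.
have ReZ (t : R) (u : R[i]) : complex.Re (t%:C%C * u) = t * complex.Re u.
  by case: u => u1 u2 /=; rewrite mul0r subr0.
have -> : h * (a%:C%C / (w + 1) + b%:C%C / (w - 1) +
               \sum_(r <- s) (w - r)^-1) =
    a%:C%C * (h / (w - (-1)%:C%C)) + b%:C%C * (h / (w - 1%:C%C))
    + \sum_(r <- s) h / (w - r).
  by rewrite -mulr_sumr rmorphN1 rmorph1 opprK; field; rewrite w1 w2.
(* The charge a at -1 is positive, so the real part is positive and not just
   nonnegative. *)
rewrite !ReD !ReZ => /eqP; apply/negP; rewrite gt_eqF //.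
have h1 := hh (-1); have h2 := hh 1.
apply: ltr_wpDr; last first.
  apply: ltr_wpDr; last by apply: mulr_gt0 => //; apply: h1; lra.
  by apply: mulr_ge0 => //; apply: ltW; apply: h2; lra.
rewrite big_seq; elim/big_ind: _ => [//|u v hu hv|r rs]; first by rewrite ReD addr_ge0.
have /andP[/eqP im re] := sK r rs.
case: r im re {rs} => r1 r2 /= -> re.
exact: ltW (hh _ re).
Qed.

(** Here a = n - k + theta and b = n - k - theta; the latter is nonnegative as
    long as k < n, which is where theta <= 1 is used. *)
Lemma rodrigues_roots (R : rcfType) (n : nat) (theta : R) (k : nat) (w : R[i]) :
  0 <= theta <= 1 -> (k <= n)%N ->
  root (map_poly (real_complex R) (rodrigues n theta k)) w -> in_segment w.
Proof.
move=> /andP[t0 t1]; elim: k w => [|k IH] w kn /=.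
  by rewrite rmorph1 (negPf (root1 _)).
have k1 : k.+1%:R <= n%:R :> R by rewrite ler_nat.
rewrite -natr1 in k1.
have a0 : 0 < n%:R - k%:R + theta by lra.
have b0 : 0 <= n%:R - k%:R - theta by lra.
set Q := map_poly (real_complex R) (rodrigues n theta k).
rewrite -[X in root X w -> _](_ :
    (((n%:R - k%:R + theta)%:C)%C%:P * (1 - 'X)
     - ((n%:R - k%:R - theta)%:C)%C%:P * (1 + 'X)) * Q
    + (1 - 'X ^+ 2) * Q^`() = _).
  by apply: gauss_lucas_segment => // r; apply: IH; exact: ltnW.
rewrite /Q deriv_map.
rewrite !(rmorphD, rmorphB, rmorphM, rmorphXn, rmorphN, rmorph1) /=.
rewrite map_polyC map_polyX /= !(rmorphD, rmorphB, rmorph_nat) /=; ring.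
Qed.

Lemma jacobi_roots_in_segment (R : realType) (n : nat) (theta : R) (w : R[i]) :
  0 <= theta <= 1 -> jacobi n theta != 0 ->
  root (map_poly (real_complex R) (jacobi n theta)) w -> in_segment w.
Proof.
move=> t01 J0 hw; apply: (rodrigues_roots t01 (leqnn n)).
move: hw; rewrite (jacobi_rodrigues J0) map_polyZ rootZ //.
by rewrite fmorph_eq0 mulf_neq0 ?signr_eq0 // mulf_neq0 ?invr_eq0 ?pnatr_eq0 //.
Qed.

(** * Primitives of even polynomials *)

Definition primitive (F : fieldType) (p : {poly F}) : {poly F} :=
  \poly_(i < (size p).+1) (p`_i.-1 / i%:R).

Lemma deriv_primitive (F : numFieldType) (p : {poly F}) : (primitive p)^`() = p.
Proof.
apply/polyP => i; rewrite coef_deriv coef_poly ltnS /=.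
case: ltnP => [_|/leq_sizeP->//]; last by rewrite mul0rn.
by rewrite -mulrnAr -[_^-1 *+ _]mulr_natr mulVf ?mulr1 // pnatr_eq0.
Qed.

Lemma primitive0 (F : fieldType) (p : {poly F}) : (primitive p).[0] = 0.
Proof. by rewrite horner_coef0 coef_poly invr0 mulr0. Qed.

Lemma primitive_increment_gt0 (R : rcfType) (p : {poly R}) (a b : R) :
  a < b -> (forall t, a < t < b -> 0 < p.[t]) ->
  0 < (primitive p).[b] - (primitive p).[a].
Proof.
move=> ab hp; have [c cab ->] := poly_mvt (primitive p) ab.
by rewrite deriv_primitive mulr_gt0 ?subr_gt0 // hp // !(itvP cab).
Qed.

Lemma coef_comp_polyNX (R : comNzRingType) (p : {poly R}) (i : nat) :
  (p \Po (- 'X))`_i = (-1) ^+ i * p`_i.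
Proof.
rewrite comp_polyE (eq_bigr (fun j : 'I_(size p) => ((-1) ^+ j * p`_j) *: 'X^j)).
  rewrite -(poly_def _ (fun j => (-1) ^+ j * p`_j)) coef_poly.
  by case: ltnP => // /leq_sizeP ->; rewrite ?mulr0.
move=> j _; rewrite [in LHS]exprNn -!mul_polyC polyCM polyC_exp polyCN; ring.
Qed.

Lemma primitive_even_odd (F : numFieldType) (p : {poly F}) (x : F) :
  p \Po (- 'X) = p ->
  (primitive p).[- x] = - (primitive p).[x].
Proof.
move=> pe.
have -> : (primitive p).[- x] = (primitive p \Po (- 'X)).[x].
  by rewrite horner_comp hornerN hornerX.
rewrite -hornerN; congr (_.[_]); apply/polyP => -[|i].
  by rewrite coef_comp_polyNX coefN coef_poly invr0 !mulr0 oppr0.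
rewrite coef_comp_polyNX coefN exprS mulN1r mulNr; congr (- _).
rewrite coef_poly; case: ifP => _; rewrite ?mulr0 //.
by rewrite mulrA -coef_comp_polyNX pe.
Qed.

(** The primitive of an even polynomial of degree at most 2n - 2 only has odd
    powers of exponent at most 2n - 1, and a linear combination of power sums
    that are all equal to theta is theta times its value at 1. *)
Lemma sum_primitive_even (F : numFieldType) (n : nat) (r : 'I_n -> F) (theta : F)
    (p : {poly F}) : (0 < n)%N ->
  (forall k, (k < n)%N -> \sum_i r i ^+ k.*2.+1 = theta) ->
  p \Po (- 'X) = p -> (size p <= (2 * n - 2).+1)%N ->
  \sum_i (primitive p).[r i] = theta * (primitive p).[1].
Proof.
move=> n0 hr pe sp.
under eq_bigr do rewrite horner_poly.
rewrite exchange_big horner_poly mulr_sumr; apply: eq_bigr => -[j jp] _ /=.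
rewrite -mulr_sumr expr1n mulr1 mulrC.
case: j jp => [|j] jp; first by rewrite invr0 !mulr0.
have [jo|je] := boolP (odd j).
  have := congr1 (fun q : {poly F} => q`_j) pe; rewrite coef_comp_polyNX.
  rewrite -signr_odd jo expr1 mulN1r => /eqP.
  rewrite eq_sym -addr_eq0 -mulr2n mulrn_eq0 => /eqP /= ->.
  by rewrite mul0r !mulr0.
have jE : j = j./2.*2 by rewrite -[LHS]odd_double_half (negPf je).
rewrite {1}jE hr //.
by move: jp sp jE; move: (size p) (j./2) => d k; lia.
Qed.

(** * Step functions orthogonal to even polynomials *)

(** The product telescopes, since squares of signs are 1. *)
Lemma prod_consecutive_signs (R : comNzRingType) (n m : nat) (e : nat -> bool) :
  (m <= n)%N ->
  \prod_(i < n | (m <= i)%N) ((-1) ^+ e i * (-1) ^+ e i.+1) =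
     (-1) ^+ e m * (-1) ^+ e n :> R.
Proof.
elim: n => [|n IH].
  by rewrite leqn0 => /eqP ->; rewrite big_ord0 -expr2 sqrr_sign.
rewrite leq_eqVlt ltnS => /orP[/eqP <-|mn].
  rewrite big1 -?expr2 ?sqrr_sign // => i.
  by rewrite leqNgt ltn_ord.
rewrite big_mkcond big_ord_recr /= mn -big_mkcond /= IH // mulrA.
by congr (_ * _); rewrite -mulrA -expr2 sqrr_sign mulr1.
Qed.

(** The sum is the integral of (f - theta) p, where f takes the value f m
    between x m and x m.+1.  Give f m the sign + when f m >= 1 and - otherwise;
    as f m is an integer and 0 <= theta <= 1, this is also a weak sign of
    f m - theta.  If all n steps change the sign, neighbouring values lie on both
    sides of the threshold and, differing by 1, are 0 and 1.  Otherwise the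
    product of the t^2 - (x m)^2 over the sign changes is an admissible p that
    has the sign of f - theta up to a global sign, hence f m = theta on every
    nondegenerate interval. *)
Lemma step_values_in01 (R : rcfType) (n : nat) (theta : R) (x : nat -> R)
    (f : nat -> int) :
  (0 < n)%N -> 0 <= theta <= 1 -> x 0%N = 0 ->
  (forall m, (m <= n)%N -> x m <= x m.+1) ->
  (forall m, (m < n)%N -> f m.+1 = f m + 1 \/ f m.+1 = f m - 1) ->
  (forall p : {poly R}, p \Po (- 'X) = p -> (size p <= (2 * n - 2).+1)%N ->
    \sum_(m < n.+1) ((f m)%:~R - theta) *
       ((primitive p).[x m.+1] - (primitive p).[x m]) = 0) ->
  forall m, (m <= n)%N -> x m < x m.+1 -> f m = 0 \/ f m = 1.
Proof.
move=> n0 /andP[t0 t1] x0 xle fstep orth m mn xm.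
(* The sign given to f k is (-1) ^+ e k. *)
pose e i := f i <= 0.
have [allc|/forallPn[i0 nc]] := boolP [forall i : 'I_n, e i != e i.+1].
  have H i : (i < n)%N -> (f i = 0 \/ f i = 1) /\ (f i.+1 = 0 \/ f i.+1 = 1).
    move=> ltin; have /forallP/(_ (Ordinal ltin)) := allc; rewrite /e /=.
    by have := fstep _ ltin; lia.
  move: mn; rewrite leq_eqVlt => /orP[/eqP ->|/H[]//].
  by case: n n0 H {allc xle fstep orth} => // n _ H; case: (H n (ltnSn n)).
have xmono i j : (i <= j)%N -> (j <= n.+1)%N -> x i <= x j.
  elim: j => [|j IH]; first by rewrite leqn0 => /eqP ->.
  rewrite leq_eqVlt => /orP[/eqP ->//|ij] jn.
  by apply: le_trans (xle j _) => //; apply: IH => //; exact: ltnW.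
pose h : {poly R} := \prod_(i < n | e i != e i.+1) ('X ^+ 2 - (x i.+1 ^+ 2)%:P).
(* On the k-th interval, the factors of h with index at least k are negative and
   the other ones are positive; the sign changes from k to n compensate
   exactly the negative ones. *)
have hpos k t : (k <= n)%N -> x k < t < x k.+1 -> 0 < (-1) ^+ e k * (-1) ^+ e n * h.[t].
  move=> kn /andP[xt tx].
  have tpos : 0 < t by apply: le_lt_trans xt; rewrite -x0 xmono // ltnW.
  rewrite -(prod_consecutive_signs _ _ kn) /h horner_prod.
  rewrite big_mkcond [X in _ * X]big_mkcond -big_split.
  apply: prodr_gt0 => i _ /=; rewrite !hornerE.
  have xi0 : 0 <= x i.+1 by rewrite -x0 xmono // ltnS ltnW.
  have sgn : (-1) ^+ e i * (-1) ^+ e i.+1 =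
             (if e i == e i.+1 then 1 else -1) :> R.
    by case: (e i); case: (e i.+1); rewrite /= ?expr0 ?expr1; lra.
  rewrite sgn. case: leqP => [ki|ik]; case: eqVneq => _ /=; rewrite ?mulr1 //.
  - rewrite mulN1r opprB subr_gt0 ltr_pXn2r ?nnegrE ?(ltW tpos) //.
    by apply: (lt_le_trans tx); apply: xmono; rewrite ?ltnS // ltnW.
  - rewrite mul1r subr_gt0 ltr_pXn2r ?nnegrE ?(ltW tpos) //.
    by apply: (le_lt_trans _ xt); apply: xmono => //; exact: ltnW.
have hinc k : (k <= n)%N -> x k < x k.+1 ->
    0 < (-1) ^+ e k * (-1) ^+ e n *
        ((primitive h).[x k.+1] - (primitive h).[x k]).
  move=> kn xk; have := hpos k _ kn.
  rewrite -signr_addb; case: (_ (+) _); rewrite ?expr1 ?expr0 => hp; last first.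
    rewrite mul1r; apply: primitive_increment_gt0 => // t /hp.
    by rewrite mul1r.
  have -> : primitive h = - primitive (- h).
    apply/polyP => i; rewrite coefN !coef_poly size_polyN.
    case: ifP; rewrite ?oppr0 //.
    by rewrite coefN mulNr opprK.
  rewrite mulN1r !hornerN -opprD opprK.
  by apply: primitive_increment_gt0 => // t /hp; rewrite hornerN mulN1r.
have heven : h \Po (- 'X) = h.
  rewrite /h rmorph_prod /=; apply: eq_bigr => i _.
  by rewrite comp_polyB comp_polyC rmorphXn /= comp_polyX sqrrN.
(* Some step does not change the sign, which leaves at most n - 1 factors. *)
have hsize : (size h <= (2 * n - 2).+1)%N.
  have : (size h <= (2 * #|[pred i : 'I_n | e i != e i.+1]|).+1)%N.
    rewrite /h -sum1_card big_distrr /=.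
    elim/big_rec2: _ => [|i k q _ IH]; first by rewrite size_poly1.
    apply: leq_trans (size_polyMleq _ _) _.
    have : (size ('X^2 - (x i.+1 ^+ 2)%:P : {poly R})%R <= 3)%N.
      by rewrite size_XnsubC.
    by move: (size q) (size _) IH => a b; lia.
  move=> /leq_trans; apply; rewrite ltnS.
  suff : (#|[pred i : 'I_n | e i != e i.+1]| < n)%N by lia.
  rewrite -[X in (_ < X)%N]card_ord; apply: proper_card; apply/properP; split.
    by apply/fintype.subsetP.
  by exists i0.
have := orth h heven hsize => S0.
have fsign k : 0 <= ((f k)%:~R - theta) * (-1) ^+ e k.
  rewrite /e; case: (leP (f k) 0) => fk /=.
    by rewrite expr1 mulrN1 opprB subr_ge0 (le_trans _ t0) // lerz0.
  rewrite expr0 mulr1 subr_ge0 (le_trans t1) //.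
  by rewrite -[1]/(1%:~R) ler_int; lia.
have term_ge0 k : (k <= n)%N -> 0 <= (-1) ^+ e n * (((f k)%:~R - theta) *
       ((primitive h).[x k.+1] - (primitive h).[x k])).
  move=> kn; have := xle k kn; rewrite le_eqVlt => /orP[/eqP ->|xk].
    by rewrite subrr !mulr0.
  have := mulr_ge0 (fsign k) (ltW (hinc k kn xk)).
  congr (_ <= _).
  by rewrite -[RHS]mul1r -[X in _ = X * _](sqrr_sign R (e k)); ring.
have S1 : \sum_(k < n.+1) (-1) ^+ e n * (((f k)%:~R - theta) *
       ((primitive h).[x k.+1] - (primitive h).[x k])) = 0.
  by rewrite -mulr_sumr S0 mulr0.
have : (f m)%:~R - theta = 0.
  have tm := psumr_eq0P (fun (k : 'I_n.+1) _ => term_ge0 k (ltn_ord k)) S1.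
  have /eqP := tm (Ordinal (mn : (m < n.+1)%N)) isT.
  rewrite mulf_eq0 signr_eq0 mulf_eq0 /= => /orP[/eqP//|].
  have := hinc m mn xm; move=> /[swap] /eqP ->; by rewrite mulr0 ltxx.
move=> /eqP; rewrite subr_eq0 => /eqP fm.
move: t0 t1; rewrite -fm ler0z -[1 in X in _ -> X -> _]/(1%:~R) ler_int; lia.
Qed.

Lemma step_parity (n : nat) (f : nat -> int) :
  (forall m, (m < n)%N -> f m.+1 = f m + 1 \/ f m.+1 = f m - 1) ->
  forall m, (m <= n)%N -> exists k : int, f m = f n + (n - m)%N%:Z + 2 * k.
Proof.
move=> fs m mn; rewrite -(subKn mn); move: (n - m)%N (leq_subr m n) => j.
elim: j => [|j IH] jn; first by exists 0; rewrite subn0 subnn; lia.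
have [k hk] := IH (ltnW jn).
have -> : (n - (n - j.+1) = (n - (n - j)).+1)%N by lia.
have lt : (n - j.+1 < n)%N by lia.
have := fs _ lt; have -> : ((n - j.+1).+1 = n - j)%N by lia.
by rewrite hk => -[h|h]; [exists (k - 1)|exists k]; lia.
Qed.

Lemma step01_sign (R : comNzRingType) (n m : nat) (v k : int) :
  (m <= n)%N -> v = (n - m)%N%:Z + 2 * k -> v = 0 \/ v = 1 ->
  (-1) ^+ m = - (-1) ^+ n * (2%:R * v%:~R - 1) :> R.
Proof.
move=> mn vE v01.
have -> : n = ((n - m) + m)%N by rewrite subnK.
rewrite exprD; move: vE; move: (n - m)%N => d vE.
have -> : (-1) ^+ d = (-1) ^+ odd d :> R by rewrite signr_odd.
case: v01 => v01; rewrite v01.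
  have -> : odd d = false by lia.
  by rewrite expr0 -[0%:~R]/(0 : R); ring.
have -> : odd d = true by lia.
by rewrite expr1 -[1%:~R]/(1 : R); ring.
Qed.

(** Summation by parts: each s i is carried by all the intervals below its
    index, whose increments of g telescope. *)
Lemma tail_sum_abel (R : comNzRingType) (n : nat) (s : 'I_n -> R) (g : nat -> R) :
  \sum_(m < n.+1) (\sum_(i < n | (m <= i)%N) s i) * (g m.+1 - g m) =
  \sum_(i < n) s i * (g i.+1 - g 0%N).
Proof.
under eq_bigr do rewrite big_distrl /= big_mkcond.
rewrite exchange_big /=; apply: eq_bigr => i _.
rewrite -big_mkcond -mulr_sumr /=; congr (_ * _).
rewrite -(telescope_sumr g (leq0n i.+1)) [RHS]big_mkord.
by rewrite (big_ord_widen n.+1 (fun m => g m.+1 - g m)) ?ltnS 1?ltnW.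
Qed.

(** * Integrals against a step function *)

Lemma integrable_poly (R : realType) (p : {poly R}) (D : set (measurableTypeR R)) :
  measurable D -> D `<=` `[0, 1]%classic ->
  (@lebesgue_measure R).-integrable D (EFin \o horner p).
Proof.
move=> mD D01.
have i01 : (@lebesgue_measure R).-integrable `[0, 1]%classic (EFin \o horner p).
  apply: continuous_compact_integrable; first exact: segment_compact.
  by apply: continuous_subspaceT => x; exact: continuous_horner.
exact: (integrableS _ mD D01 i01).
Qed.

Lemma Rintegral_poly (R : realType) (p : {poly R}) (a b : R) :
  0 <= a -> a <= b -> b <= 1 ->
  \int[@lebesgue_measure R]_(t in `[a, b[) p.[t] =
    (primitive p).[b] - (primitive p).[a].
Proof.
move=> a0; rewrite le_eqVlt => /predU1P[->|ab] b1.
  by rewrite set_itvco0 Rintegral_set0 subrr.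
rewrite Rintegral_itv_bndo_bndc; last first.
  apply: integrable_poly => // t /=; rewrite !in_itv /= => /andP[at_ tb].
  by rewrite (le_trans a0) // (le_trans (ltW tb)).
rewrite /Rintegral (@continuous_FTC2 _ (horner p) (horner (primitive p))) //.
- by apply: continuous_subspaceT => x; exact: continuous_horner.
- split=> [x _||].
  + exact: derivable_horner.
  + by apply: cvg_at_right_filter; exact: continuous_horner.
  + by apply: cvg_at_left_filter; exact: continuous_horner.
- by move=> x _; rewrite -derive.derivE deriv_primitive.
Qed.

(** Integrability is part of the conclusion because the induction needs it. *)
Lemma Rintegral_finite_sum (R : realType) (I : Type) (s : seq I)
    (f : I -> R -> R)
    (D : set (measurableTypeR R)) (mu := @lebesgue_measure R) :
  measurable D -> (forall i, mu.-integrable D (EFin \o f i)) ->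
  mu.-integrable D (EFin \o (fun t => \sum_(i <- s) f i t)) /\
  \int[mu]_(t in D) (\sum_(i <- s) f i t) = \sum_(i <- s) \int[mu]_(t in D) f i t.
Proof.
move=> mD fi; elim: s => [|i s [IH1 IH2]].
  rewrite big_nil.
  under [X in X = _]eq_Rintegral do rewrite big_nil.
  rewrite Rintegral_cst // mul0r; split=> //.
  under eq_fun do rewrite big_nil; exact: integrable0.
rewrite big_cons -IH2 -RintegralD //; split.
  under eq_fun do rewrite big_cons.
  exact: (integrableD mD (fi i) IH1).
by apply: eq_Rintegral => t _; rewrite big_cons.
Qed.

(** Away from the point 1, which is negligible, the integrand is a combination
    of the restrictions of p to the intervals between consecutive nodes. *)
Lemma pairing_Sigma (R : realType) (n : nat) (x : n.-tuple R) (lambda : R)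
    (p : {poly R}) :
  Delta x ->
  pairing (fun t => p.[t]) (fun t => Sigma x t - lambda) =
  \sum_(m < n.+1) ((-1) ^+ m - lambda) *
     ((primitive p).[node x m.+1] - (primitive p).[node x m]).
Proof.
move=> dx; set mu := @lebesgue_measure R.
have node0 : node x 0 = 0 by [].
have node1 : node x n.+1 = 1 by rewrite /node nth_default //= size_tuple.
have mono i j : (i <= j)%N -> (j <= n.+1)%N -> node x i <= node x j.
  elim: j => [|j IH]; first by rewrite leqn0 => /eqP ->.
  rewrite leq_eqVlt => /orP[/eqP ->//|ij] jn.
  by apply: le_trans (dx j _) => //; apply: IH => //; exact: ltnW.
have nge0 i : (i <= n.+1)%N -> 0 <= node x i by move=> ?; rewrite -node0 mono.
have nle1 i : (i <= n.+1)%N -> node x i <= 1 by move=> ?; rewrite -node1 mono.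
pose D : set (measurableTypeR R) := `[0, 1[%classic.
have mD : measurable D by exact: measurable_itv.
have D01 : D `<=` `[0, 1]%classic.
  by move=> t; rewrite /D /= !in_itv /= => /andP[-> /ltW ->].
pose J (m : 'I_n.+1) : set (measurableTypeR R) := `[node x m, node x m.+1[%classic.
have JD m : J m `<=` D.
  move=> t; rewrite /J /D /= !in_itv /= => /andP[h1 h2].
  rewrite (le_trans (nge0 _ (ltnW (ltn_ord m)))) //=.
  by rewrite (lt_le_trans h2) // nle1.
pose h (m : 'I_n.+1) (t : R) : R := (-1) ^+ m * (p.[t] * \1_(J m) t).
have ip : mu.-integrable D (EFin \o horner p) by exact: integrable_poly.
have ipJ m : mu.-integrable D (EFin \o (fun t => p.[t] * \1_(J m) t)).
  apply: (le_integrable mD _ _ ip).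
    apply/measurable_EFinP/measurable_funM; first exact: measurable_poly.
    apply: measurable_indic; exact: measurable_itv.
  move=> t _ /=; rewrite lee_fin normrM ler_piMr // indicE.
  by case: (t \in _); rewrite ?normr1 ?normr0.
have ih m : mu.-integrable D (EFin \o h m).
  exact: (integrableZl mD ((-1) ^+ m) (ipJ m)).
have [iS IS] := Rintegral_finite_sum (index_enum 'I_n.+1) mD ih.
have ilp : mu.-integrable D (EFin \o (fun t => lambda * p.[t])).
  exact: (integrableZl mD lambda ip).
have gE t : t \in D -> (Sigma x t - lambda) * p.[t] = \sum_m h m t - lambda * p.[t].
  rewrite inE /D /= in_itv /= => /andP[_ t1].
  rewrite /Sigma lt_eqF // mulrBl mulr_suml; congr (_ - _).
  by apply: eq_bigr => m _; rewrite /h mulrAC mulrA.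
rewrite /pairing -/mu -Rintegral_itv_bndo_bndc -/D; last first.
  apply: (eq_integrable mD (EFin \o (fun t => \sum_m h m t - lambda * p.[t]))).
    by move=> t tD /=; rewrite gE.
  exact: (integrableB mD iS ilp).
rewrite (@eq_Rintegral _ _ _ mu D
  (fun t => \sum_m h m t - lambda * p.[t]) _ gE).
rewrite RintegralB // IS RintegralZl // Rintegral_poly //.
transitivity (\sum_(m < n.+1) (-1) ^+ m *
     ((primitive p).[node x m.+1] - (primitive p).[node x m])
   - lambda * \sum_(m < n.+1)
     ((primitive p).[node x m.+1] - (primitive p).[node x m])).
  congr (_ - lambda * _).
    apply: eq_bigr => m _; rewrite /h RintegralZl //; congr (_ * _).
    rewrite -[RHS]Rintegral_poly ?nge0 ?nle1 //; [|exact: ltnW|exact: mono].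
    rewrite -/(J m).
    have -> : \int[mu]_(t in J m) p.[t] = \int[mu]_(t in D `&` J m) p.[t].
      by rewrite setIidr //; exact: JD.
    rewrite Rintegral_mkcondr.
    by apply: eq_Rintegral => t _; rewrite patch_indic.
  rewrite -node1 -{2}node0.
  rewrite -(telescope_sumr (fun m => (primitive p).[node x m]) (leq0n n.+1)).
  by rewrite big_mkord.
rewrite mulr_sumr -sumrB; apply: eq_bigr => m _; ring.
Qed.

(** * Moduli of the Jacobi roots *)

Theorem theorem5p1 (R : realType) (n : nat) (lambda : R)
  (hn : (1 <= n)%N) (hlambda : -1 <= lambda <= 1)
  (theta : R) (htheta : theta = (1 + (-1) ^+ (n - 1) * lambda) / 2)
  (zeta : n.-tuple (complex R))
  (hzeta : map_poly (real_complex R) (jacobi n theta)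
           = \prod_(z <- zeta) ('X - z%:P))
  (hsorted : sorted (fun z w => Normc.normc z <= Normc.normc w) zeta)
  (x : n.-tuple R) (hx : forall i : 'I_n, tnth x i = Normc.normc (tnth zeta i)) :
  [/\ Delta x,
      Dset n (Sigma x) &
      forall p : {poly R}, p \Po (- 'X) = p -> (size p <= (2 * n - 2).+1)%N ->
        pairing (fun t => p.[t]) (fun t => Sigma x t - lambda) = 0].
Proof.
have t01 : 0 <= theta <= 1.
  have [l1 l2] := andP hlambda; rewrite htheta -signr_odd.
  by case: (odd _); rewrite ?expr0 ?expr1; lra.
have J0 : jacobi n theta != 0.
  rewrite -(map_poly_eq0 (real_complex R)) hzeta.
  by rewrite monic_neq0 // monic_prod_XsubC.
have zK i : in_segment (tnth zeta i).
  apply: (jacobi_roots_in_segment t01 J0).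
  by rewrite hzeta root_prod_XsubC mem_tnth.
pose r i := complex.Re (tnth zeta i).
have zr i : tnth zeta i = (r i)%:C%C.
  by have := zK i; rewrite /r; case: (tnth zeta i) => a b /andP[/eqP /= ->].
have r1 i : `|r i| <= 1.
  by have /andP[_] := zK i; rewrite -/(r i) ler_norml.
have xr i : tnth x i = `|r i|.
  by rewrite hx zr /= expr0n addr0 sqrtr_sqr.
have Jr : jacobi n theta = \prod_i ('X - (r i)%:P).
  apply: (map_poly_inj (real_complex R)); rewrite hzeta big_tuple rmorph_prod.
  by apply: eq_bigr => i _; rewrite /= map_polyXsubC zr.
have ps := jacobi_power_sums Jr.
have node0 : node x 0 = 0 by [].
have nodeS (i : 'I_n) : node x i.+1 = `|r i|.
  by rewrite -xr (tnth_nth 1).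
have node1 : node x n.+1 = 1 by rewrite /node nth_default //= size_tuple.
have dx : Delta x.
  move=> m; rewrite leq_eqVlt => /predU1P[->|mn].
    have n1 : (n.-1 < n)%N by rewrite prednK.
    by have := nodeS (Ordinal n1); rewrite /= prednK // node1 => ->.
  rewrite (nodeS (Ordinal mn)); case: m mn => [|m] mn; first by rewrite node0.
  rewrite (nodeS (Ordinal (ltnW mn))) -!xr !hx !(tnth_nth 0) /=.
  by move/(sortedP 0): hsorted; apply; rewrite size_tuple.
split=> //; first by exists x; [exact: dx|exact: ae_eq_refl].
move=> p pe sp; rewrite pairing_Sigma //.
(* f m is the value on the m-th interval of the number of roots above t minus the
   number of roots below -t.
   A root equal to 0 is counted as positive; only degenerate intervals precede it. *)
pose sg (i : 'I_n) : int := if r i < 0 then -1 else 1.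
pose f (m : nat) : int := \sum_(i < n | (m <= i)%N) sg i.
have fn : f n = 0.
  by rewrite /f big1 // => i; rewrite leqNgt ltn_ord.
have fstep m : (m < n)%N -> f m.+1 = f m + 1 \/ f m.+1 = f m - 1.
  move=> mn; have -> : f m = sg (Ordinal mn) + f m.+1.
    rewrite /f (bigD1 (Ordinal mn)) //=; congr (_ + _); apply: eq_bigl => i.
    by rewrite ltn_neqAle andbC -val_eqE /= eq_sym.
  by rewrite /sg; case: ifP => _; [left|right]; lia.
have orth q : q \Po (- 'X) = q -> (size q <= (2 * n - 2).+1)%N ->
    \sum_(m < n.+1) ((f m)%:~R - theta) *
       ((primitive q).[node x m.+1] - (primitive q).[node x m]) = 0.
  move=> qe sq; pose g m := (primitive q).[node x m].
  under eq_bigr do rewrite mulrBl.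
  rewrite sumrB -mulr_sumr.
  have -> : \sum_(m < n.+1) ((primitive q).[node x m.+1]
      - (primitive q).[node x m]) = g n.+1 - g 0%N.
    by rewrite -(telescope_sumr g (leq0n n.+1)) big_mkord.
  under eq_bigr do rewrite rmorph_sum.
  (* After summation by parts, the primitive of q, which is odd, is evaluated at
     the roots themselves instead of their moduli. *)
  rewrite (tail_sum_abel (fun i => (sg i)%:~R) g).
  rewrite /g node1 node0 primitive0 subr0 -(sum_primitive_even hn ps qe sq).
  rewrite -sumrB big1 // => i _; rewrite nodeS subr0 /sg.
  case: ltrP => ri; last by rewrite mul1r ger0_norm ?subrr.
  by rewrite mulN1r ltr0_norm // primitive_even_odd // opprK subrr.
have f01 := step_values_in01 hn t01 node0 dx fstep orth.
(* On every nondegenerate interval,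
   sigma - lambda = - (-1)^n 2 (f - theta). *)
transitivity (- (-1) ^+ n * 2%:R * \sum_(m < n.+1) ((f m)%:~R - theta) *
       ((primitive p).[node x m.+1] - (primitive p).[node x m])); last first.
  by rewrite orth // mulr0.
rewrite mulr_sumr; apply: eq_bigr => -[m mn] _ /=; rewrite ltnS in mn.
have := dx m mn; rewrite le_eqVlt => /predU1P[->|xm].
  by rewrite subrr !mulr0.
have [k fk] := step_parity fstep mn; rewrite fn add0r in fk.
have sn : (-1) ^+ n = - (-1) ^+ (n - 1) :> R.
  by rewrite -[n in LHS](subnK hn) addn1 exprS mulN1r.
have s2 : (-1) ^+ (n - 1) * (-1) ^+ (n - 1) = 1 :> R by rewrite -expr2 sqrr_sign.
rewrite (step01_sign R mn fk (f01 m mn xm)) sn htheta mulrA; congr (_ * _).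
apply: subr0_eq.
transitivity (((-1) ^+ (n - 1) * (-1) ^+ (n - 1) - 1) * lambda).
  by field.
by rewrite s2 subrr mul0r.
Qed.
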